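(* Let $(X,d)$ be a connected compact metric space and let $\mathcal{F}=\{X; f_{\lambda}\mid\lambda\in\Lambda\}$ be an iterated function system consisting of continuous maps $f_\lambda:X\to X$, where $\Lambda$ is a finite nonempty set. Then the following are equivalent: (1) $\mathcal{F}$ is chain mixing. (2) $\mathcal{F}$ is totally chain transitive. (3) $\mathcal{F}$ is chain transitive. (4) $\mathcal{F}$ is chain recurrent.
   Context: An iterated function system (IFS) $\mathcal{F}=\{X; f_{\lambda}\mid\lambda\in\Lambda\}$ is a family of continuous maps $f_\lambda:X\to X$ indexed by a finite nonempty set $\Lambda$, where $(X,d)$ is a compact metric space. For $\epsilon>0$, an $\epsilon$-chain of $\mathcal{F}$ from $x$ to $y$ of length $n\ge 1$ is a finite sequence $x=x_0,x_1,\dots,x_n=y$ in $X$ for which there exist $\lambda_0,\dots,\lambda_{n-1}\in\Lambda$ with $d(x_{i+1},f_{\lambda_i}(x_i))<\epsilon$ for all $0\le i<n$. $\mathcal{F}$ is chain recurrent if for every $x\in X$ and every $\epsilon>0$ there is an $\epsilon$-chain from $x$ to itself. $\mathcal{F}$ is chain transitive if for all $x,y\in X$ and every $\epsilon>0$ there is an $\epsilon$-chain from $x$ to $y$. For an integer $n\ge 1$, $\mathcal{F}^{n}$ denotes the IFS on $X$ consisting of all compositions $f_{\lambda_{n}}\circ\cdots\circ f_{\lambda_{1}}$ with $\lambda_1,\dots,\lambda_n\in\Lambda$ (indexed by $\Lambda^n$). $\mathcal{F}$ is totally chain transitive if $\mathcal{F}^n$ is chain transitive for all $n\ge 1$. $\mathcal{F}$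 is chain mixing if for every $\epsilon>0$ there is $N>0$ such that for all $x,y\in X$ and every $n>N$ there is an $\epsilon$-chain of $\mathcal{F}$ from $x$ to $y$ of length exactly $n$. *)

(* Defs.v *)
From mathcomp Require Import all_boot all_order all_algebra.
From mathcomp Require Import all_classical reals topology.
Set Implicit Arguments.
Unset Strict Implicit.
Unset Printing Implicit Defensive.
Local Open Scope ring_scope.

(* An iterated function system on [X] is a finite family [f : L -> X -> X];
   continuity of the maps and nonemptiness of [L] are separate hypotheses. *)
Section IteratedFunctionSystem.
Variables (R : realType) (X : metricType R) (L : finType).
Implicit Types (f : L -> X -> X) (eps : R) (x y : X) (n : nat).

(* The points and indices are presented as sequences on [nat], of which only
   [c 0, ..., c n] and [l 0, ..., l n.-1] are constrained. *)
Definition eps_chain f eps n x y : Prop :=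
  (0 < n)%N /\
  exists (c : nat -> X) (l : nat -> L),
    [/\ c 0%N = x, c n = y
      & forall i, (i < n)%N -> mdist (c i.+1) (f (l i) (c i)) < eps].

Definition chain_recurrent f : Prop :=
  forall x eps, 0 < eps -> exists n, eps_chain f eps n x x.

Definition chain_transitive f : Prop :=
  forall x y eps, 0 < eps -> exists n, eps_chain f eps n x y.

Definition chain_mixing f : Prop :=
  forall eps, 0 < eps ->
    exists2 N, (0 < N)%N & forall x y n, (N < n)%N -> eps_chain f eps n x y.

(* The map indexed by [(l_1, ..., l_n)] is [f l_n \o ... \o f l_1]. *)
Definition ifs_power f n (t : n.-tuple L) (x : X) : X :=
  foldl (fun z l => f l z) x t.

End IteratedFunctionSystem.

Definition totally_chain_transitive (R : realType) (X : metricType R)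
    (L : finType) (f : L -> X -> X) : Prop :=
  forall n, (0 < n)%N -> chain_transitive (@ifs_power R X L f n).

(* Main.v *)
Require Import Defs.
From mathcomp Require Import all_boot all_order all_algebra.
From mathcomp Require Import all_classical reals topology.

Set Implicit Arguments.
Unset Strict Implicit.
Unset Printing Implicit Defensive.

Import Order.TTheory GRing.Theory Num.Theory.

Local Open Scope classical_set_scope.
Local Open Scope ring_scope.

(* Fix [eps] and [k > 0]. The set of points reached from [x] by an
    [eps]-chain whose length is a multiple of [k] is open, because only the
    last step involves the endpoint, and closed, because a loop at a limit
    point [y] also starts, by continuity, at any point close enough to [y],
    and it may be repeated [k] times. By connectedness it is the whole space.
    Taking for [k] the length of a loop at [x] and going through [f l x] yields
    loops at [x] of the coprime lengths [k] and [k * m + 1], hence of every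
    large length. Compactness bounds the lengths of the chains to and from [x],
    and chain mixing follows. *)

Section Hops.
Variables (R : realType) (X : metricType R) (L : finType).
Implicit Types (f : L -> X -> X) (e d : R) (x y z : X) (m n k : nat).

(* Unlike [eps_chain], length [0] is allowed. *)
Fixpoint hops f e n x y : Prop :=
  if n is m.+1 then exists2 z, exists l, ball z e (f l x) & hops f e m z y
  else x = y.

Lemma eps_chainP f e n x y : eps_chain f e n x y <-> (0 < n)%N /\ hops f e n x y.
Proof.
rewrite /eps_chain; split=> -[n_gt0 h]; split=> //.
  case: h => c [l [<- <- {n_gt0 x y}]].
  elim: n c l => [//|n IHn] c l cl /=; exists (c 1%N).
    by exists (l 0%N); rewrite ballEmdist; exact: cl.
  by apply: (IHn (c \o succn) (l \o succn)) => i lt_in; exact: cl.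
case: n n_gt0 h => // n _.
elim: n x => [|n IHn] x [z [l xz]].
  move=> /= zy; exists (fun i => if i is 0 then x else y), (fun=> l).
  by split=> // -[] //= _; move: xz; rewrite zy ballEmdist.
move=> /IHn[c [k [c0 cn ck]]].
exists (fun i => if i is j.+1 then c j else x).
exists (fun i => if i is j.+1 then k j else l); split=> // -[|i] lt_in.
  by rewrite c0; move: xz; rewrite ballEmdist.
exact: ck.
Qed.

Lemma hopsD f e m n x y z :
  hops f e m x y -> hops f e n y z -> hops f e (m + n) x z.
Proof.
elim: m x => [|m IHm] x /=; first by move=> ->.
by move=> [w xw wy] yz; exists w => //; exact: IHm.
Qed.

Lemma hops_split f e m n x z : hops f e (m + n) x z ->
  exists2 y, hops f e m x y & hops f e n y z.
Proof.
elim: m x => [|m IHm] x /=; first by move=> xz; exists x.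
by move=> [w xw /IHm[y wy yz]]; exists y => //; exists w.
Qed.

Lemma hopsM f e m n x : hops f e m x x -> hops f e (n * m) x x.
Proof. by move=> xx; elim: n => [//|n IHn]; rewrite mulSn; exact: hopsD IHn. Qed.

Lemma hops_le f e d n x y : e <= d -> hops f e n x y -> hops f d n x y.
Proof.
move=> le_ed; elim: n x => [//|n IHn] x /= [z [l xz] /IHn zy].
by exists z => //; exists l; exact: le_ball xz.
Qed.

Lemma hops_recr f e n x y : hops f e n.+1 x y <->
  exists2 z, hops f e n x z & exists l, ball y e (f l z).
Proof.
rewrite -addn1; split.
  by move=> /hops_split[z xz [w wz wy]]; exists z; rewrite -?wy.
by move=> [z xz zy]; apply: hopsD xz _; exists y.
Qed.

Lemma near_ball x y e : ball x e y -> \forall z \near y, ball x e z.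
Proof.
rewrite {1}ballEmdist/= -subr_gt0 => r0.
near=> z; have: ball y (e - mdist x y) z by near: z; exact: nbhsx_ballx.
rewrite !ballEmdist/= ltrBrDl => yz.
exact: le_lt_trans (metric_triangle _ _ _) yz.
Unshelve. all: by end_near. Qed.

(** The length is positive because [hops] at length 0 is equality, which need not be an open
    condition. *)
Lemma near_hopsr f e n x y : hops f e n.+1 x y ->
  \forall z \near y, hops f e n.+1 x z.
Proof.
move=> /hops_recr[w xw [l /ball_sym/near_ball]]; apply: filterS => z wz.
by apply/hops_recr; exists w => //; exists l; exact: ball_sym.
Qed.

Lemma near_hopsl f e n x y : (forall l, continuous (f l)) ->
  hops f e n.+1 x y -> \forall z \near x, hops f e n.+1 z y.
Proof.
move=> cont_f [w [l /near_ball xw] wy].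
have : \forall z \near x, ball w e (f l z) by exact: cont_f.
by apply: filterS => z zw; exists w => //; exists l.
Qed.

Lemma hops_dvdn f e k x y : connected [set: X] ->
    (forall l, continuous (f l)) -> (0 < k)%N ->
    (forall z, exists n, hops f e n.+1 z z) ->
  exists2 n, (k %| n.+1)%N & hops f e n.+1 x y.
Proof.
move=> connX cont_f k_gt0 loop.
have {}loop z : exists2 n, (k %| n.+1)%N & hops f e n.+1 z z.
  have [n /(hopsM k)] := loop z.
  case: k k_gt0 => // k _ zz; exists (n + k * n.+1)%N => //.
  exact: (dvdn_mulr n.+1 (dvdnn _)).
pose A := [set z | exists2 n, (k %| n.+1)%N & hops f e n.+1 x z].
suff AT : A = [set: X] by have : A y by rewrite AT.
apply: connX; first by exists x; exact: loop.
  exists A; rewrite ?setTI// openE => z [n kn /near_hopsr].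
  by apply: filterS => w xw; exists n.
exists A; rewrite ?setTI// => z; have [n kn /(near_hopsl cont_f) zz] := loop z.
move=> /(_ _ zz)[w [[m km xw] wz]]; exists (m + n.+1)%N.
  by rewrite -addSn dvdn_addr.
exact: hopsD xw wz.
Qed.

(** Since [a * b + 1] is 1 modulo [a], running the longer loop [n %% a] times leaves a length
    divisible by [a], to be filled with copies of the shorter loop. As [n %% a < a], the bound on
    [n] leaves room for this. *)
Lemma hops_large f e a b x n : hops f e a x x -> hops f e (a * b).+1 x x ->
  (0 < a)%N -> (a * (a * b).+1 <= n)%N -> hops f e n x x.
Proof.
move=> xa xb a_gt0 le_n.
have le_r : (n %% a * (a * b).+1 <= n)%N.
  by apply: leq_trans le_n; rewrite leq_mul2r ltnW ?ltn_mod ?orbT.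
have /dvdnP[q nE] : (a %| n - n %% a * (a * b).+1)%N.
  by rewrite -eqn_mod_dvd// mulnS addnC mulnCA (mulnC a) modnMDl modn_mod.
by rewrite -(subnK le_r) nE; apply: hopsD; exact: hopsM.
Qed.

(** By [near_hopsl], a chain from one point gives chains of the same length from all nearby points.
    Near-covering compactness, along [N] tending to infinity, then makes the bound uniform. *)
Lemma hops_bounded_to f e y : compact [set: X] ->
    (forall l, continuous (f l)) ->
    (forall x, exists n, hops f e n.+1 x y) ->
  exists N, forall x, exists2 n, (n <= N)%N & hops f e n x y.
Proof.
move=> /compact_near_coveringP compX cont_f xy.
pose P N x := exists2 n, (n <= N)%N & hops f e n x y.
suff /filter_ex[N PN] : \forall N \near \oo, [set: X] `<=` P N.
  by exists N => x; exact: PN.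
apply: compX => x _; have [n /(near_hopsl cont_f) nx] := xy x.
exists ([set z | hops f e n.+1 z y], [set N | (n.+1 <= N)%N]).
  by split=> //; exact: nbhs_infty_ge.
by move=> [z N] [/= zy nN]; exists n.+1.
Qed.

(** The same compactness argument with the endpoint varying, through [near_hopsr]. *)
Lemma hops_bounded_from f e x : compact [set: X] ->
    (forall y, exists n, hops f e n.+1 x y) ->
  exists N, forall y, exists2 n, (n <= N)%N & hops f e n x y.
Proof.
move=> /compact_near_coveringP compX xy.
pose P N y := exists2 n, (n <= N)%N & hops f e n x y.
suff /filter_ex[N PN] : \forall N \near \oo, [set: X] `<=` P N.
  by exists N => y; exact: PN.
apply: compX => y _; have [n /near_hopsr ny] := xy y.
exists ([set z | hops f e n.+1 x z], [set N | (n.+1 <= N)%N]).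
  by split=> //; exact: nbhs_infty_ge.
by move=> [z N] [/= zy nN]; exists n.+1.
Qed.

Lemma chain_recurrent_mixing f : compact [set: X] -> connected [set: X] ->
  (forall l, continuous (f l)) -> chain_recurrent f -> chain_mixing f.
Proof.
move=> compX connX cont_f rec_f e e_gt0.
(* A base point is needed; on an empty space any [N] will do. *)
have [[x0 _]|X0] := pselect ([set: X] !=set0); last first.
  by exists 1%N => // x; case: X0; exists x.
have loop z : exists n, hops f e n.+1 z z.
  have [n /eps_chainP[]] := rec_f z _ e_gt0.
  by case: n => // n _ zz; exists n.
have trans x y : exists n, hops f e n.+1 x y.
  by have [n _ xy] := hops_dvdn x y connX cont_f (ltn0Sn 0) loop; exists n.
have [a x0a] := loop x0.
(* The first step of the loop serves only to supply an index [l]. *)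
have [_ [l _] _] := x0a.
have [b' /dvdnP[b b'E] x0b] := hops_dvdn (f l x0) x0 connX cont_f (ltn0Sn a) loop.
(* An exact step from [x0] to [f l x0], then a return whose length is a multiple of [a.+1]. *)
have {b'E}x0b : hops f e (a.+1 * b).+1 x0 x0.
  by rewrite mulnC -b'E; exists (f l x0) => //; exists l; exact: ballxx.
have [N1 to_x0] := hops_bounded_to compX cont_f (trans^~ x0).
have [N2 from_x0] := hops_bounded_from compX (trans x0).
(* [N1 + N2] covers the legs to and from [x0]; the last summand is the threshold of [hops_large] for
   the loop in between. *)
exists (N1 + N2 + a.+1 * (a.+1 * b).+1)%N => [|x y n lt_n].
  by rewrite mulSn addSn addnS.
apply/eps_chainP; split; first exact: leq_trans lt_n.
have [m1 le_m1 xx0] := to_x0 x; have [m2 le_m2 x0y] := from_x0 y.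
have le_m : (m1 + m2 <= N1 + N2)%N by exact: leq_add.
have le_m12n : (m1 + m2 <= n)%N.
  by apply: leq_trans le_m _; apply: leq_trans (ltnW lt_n); exact: leq_addr.
rewrite -(subnKC le_m12n) -addnA (addnC m2).
apply: hopsD xx0 (hopsD _ x0y); apply: hops_large x0a x0b _ _ => //.
rewrite leq_subRL//; apply: leq_trans (ltnW lt_n).
by rewrite leq_add2r.
Qed.

(** Finiteness of [L] gives, at each point, one neighbourhood good for all the maps; compactness
    then gives one radius for all points. *)
Lemma unif_continuous_ifs f e : compact [set: X] ->
    (forall l, continuous (f l)) -> 0 < e ->
  exists2 d, 0 < d & forall l x y, ball x d y -> ball (f l x) e (f l y).
Proof.
move=> /compact_near_coveringP compX cont_f e_gt0.
pose P (d : R) x := forall l y, ball x d y -> ball (f l x) e (f l y).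
suff: \forall d \near 0^'+, [set: X] `<=` P d.
  move=> nP; have [d [PD d_gt0]] : exists d, ([set: X] `<=` P d) /\ 0 < d.
    by apply/(@filter_ex _ 0^'+)/filterI => //; exact: nbhs_right_gt.
  by exists d => // l x y; exact: PD.
apply: compX => x _.
have e2_gt0 : 0 < e / 2 by rewrite divr_gt0.
have : \forall z \near x, forall l, ball (f l x) (e / 2) (f l z).
  apply: filter_forall => l; apply: cont_f; exact: nbhsx_ballx.
move=> /nbhs_ballP[r /= r_gt0 xr].
have r2_gt0 : 0 < r / 2 by rewrite divr_gt0.
exists (ball x (r / 2), [set d | d < r / 2]).
  by split; [exact: nbhsx_ballx|exact: nbhs_right_lt].
(* Both [z] and [y] lie within [r] of [x], so both images lie within [e / 2] of [f l x]. *)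
move=> [z d] [/= xz lt_d] l y zy.
have xy : ball x r y.
  by rewrite (splitr r); apply: ball_triangle xz _; apply: le_ball (ltW lt_d) _ zy.
rewrite (splitr e); apply: ball_triangle (xr _ xy l).
apply/ball_sym/xr; apply: le_ball xz.
by rewrite ler_pdivrMr// ler_peMr ?ler1n// ltW.
Qed.

(** For a fixed length the accumulated error can be made small. Half of [e] pays for the last jump,
    the other half for the earlier error carried through the last map by uniform continuity. *)
Lemma hops_shadow f e n : compact [set: X] -> (forall l, continuous (f l)) ->
    0 < e -> exists2 d, 0 < d & forall x y, hops f d n x y ->
  exists t : n.-tuple L, ball y e (ifs_power f t x).
Proof.
move=> compX cont_f; elim: n e => [|n IHn] e e_gt0.
  by exists 1 => // x _ <-; exists [tuple]; exact: ballxx.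
have e2_gt0 : 0 < e / 2 by rewrite divr_gt0.
have [d1 d1_gt0 unif_f] := unif_continuous_ifs compX cont_f e2_gt0.
have [d2 d2_gt0 shadow] := IHn _ d1_gt0.
exists (Num.min (e / 2) d2) => [|x y /hops_recr[z xz [l zy]]].
  by rewrite lt_min e2_gt0.
have le_d2 : Num.min (e / 2) d2 <= d2 by rewrite ge_min lexx orbT.
have [t zt] := shadow _ _ (hops_le le_d2 xz).
exists [tuple of rcons t l]; rewrite /ifs_power /= foldl_rcons (splitr e).
apply: ball_triangle (unif_f l _ _ zt); apply: le_ball zy.
by rewrite ge_min lexx.
Qed.

End Hops.

Section ChainTransitivity.
Variables (R : realType) (X : metricType R) (L : finType).
Implicit Types f : L -> X -> X.

Lemma chain_mixing_totally_transitive f : compact [set: X] ->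
  (forall l, continuous (f l)) -> chain_mixing f -> totally_chain_transitive f.
Proof.
move=> compX cont_f mix_f n n_gt0 x y e e_gt0.
have [d d_gt0 shadow] := hops_shadow n compX cont_f e_gt0.
have [N _ mix] := mix_f _ d_gt0.
(* A chain of length [N.+1 * n] exceeds [N] and is cut into [N.+1] blocks of [n] steps; each block
   is shadowed by one map of the [n]-th power. *)
exists N.+1; apply/eps_chainP; split=> //.
have {mix} /eps_chainP[_] := mix x y (N.+1 * n)%N (leq_pmulr _ n_gt0).
elim: N.+1 x => [//|k IHk] x; rewrite mulSn => /hops_split[z /shadow xz /IHk zy].
by exists z.
Qed.

(** This is the power [n = 1]: a 1-tuple is a single index, recovered by [thead]. *)
Lemma totally_transitive_transitive f :
  totally_chain_transitive f -> chain_transitive f.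
Proof.
move=> /(_ 1%N isT) trans_f x y e /(trans_f x y)[n [n_gt0 [c [t [c0 cn ct]]]]].
exists n; split=> //; exists c, (fun i => thead (t i)); split=> // i /ct.
by rewrite /ifs_power; case/tupleP: (t i) => l u; rewrite tuple0 theadE.
Qed.

End ChainTransitivity.

Theorem theorem4p7 (R : realType) (X : metricType R)
    (compactX : compact [set: X]) (connectedX : connected [set: X])
    (L : finType) (L_gt0 : (0 < #|L|)%N)
    (f : L -> X -> X) (cont_f : forall l : L, continuous (f l)) :
  [<-> chain_mixing f;
       totally_chain_transitive f;
       chain_transitive f;
       chain_recurrent f].
Proof.
tfae.
- exact: chain_mixing_totally_transitive.
- exact: totally_transitive_transitive.
- by move=> trans_f x; exact: trans_f.
- exact: chain_recurrent_mixing.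
Qed.
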